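(* For every $n\ge 1$, the SOSO game on a $1\times n$ grid is a draw.
   Context: SOSO game: on a $1\times n$ grid, initially empty, two players alternately write either an S or an O in an empty cell. The first player whose move produces four consecutive cells which, read from left to right, spell SOSO wins (no matter who wrote the individual letters). If all cells are filled without producing SOSO, the play ends in a draw. Both players are assumed to play optimally: ''the game is a draw'' means that each player has a strategy guaranteeing that they do not lose. *)

(* Defs.v *)
(* MathComp *)
From HB Require Import structures.
From mathcomp Require Import all_boot.

Set Implicit Arguments.
Unset Strict Implicit.
Unset Printing Implicit Defensive.

Variant letter := LetS | LetO.

Definition letter_to_bool (l : letter) : bool := if l is LetS then true else false.
Definition bool_to_letter (b : bool) : letter := if b then LetS else LetO.

Lemma letter_to_boolK : cancel letter_to_bool bool_to_letter.
Proof. by case. Qed.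

HB.instance Definition _ := Finite.copy letter (can_type letter_to_boolK).

Definition board (n : nat) := n.-tuple (option letter).
Definition move (n : nat) := ('I_n * letter)%type.

(* Moves in chronological order. *)
Definition history (n : nat) := seq (move n).

Definition empty_board (n : nat) : board n := [tuple None | i < n].

Definition write (n : nat) (b : board n) (m : move n) : board n :=
  [tuple if i == m.1 then Some m.2 else tnth b i | i < n].

Definition position (n : nat) (h : history n) : board n :=
  foldl (@write n) (empty_board n) h.

Definition has_soso (n : nat) (b : board n) : bool :=
  infix [:: Some LetS; Some LetO; Some LetS; Some LetO] b.

Definition full (n : nat) (b : board n) : bool := None \notin b.

Definition over (n : nat) (h : history n) : bool :=
  has_soso (position h) || full (position h).

Definition legal (n : nat) (h : history n) (m : move n) : bool :=
  ~~ over h && (tnth (position h) m.1 == None).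

Definition is_play (n : nat) (h : history n) : Prop :=
  forall h1 m h2, h = h1 ++ m :: h2 -> legal h1 m.

(* Players are booleans: false moves first, true moves second. *)
Definition to_move (n : nat) (h : history n) : bool := odd (size h).

(* A play stops as soon as SOSO appears, so it was produced by the last move,
   which was made by the player who is not on turn. *)
Definition won_by (n : nat) (p : bool) (h : history n) : bool :=
  has_soso (position h) && (to_move h == ~~ p).

(* The value of a strategy matters only at histories where its owner is on turn
   and the game is not over; legality is imposed in [non_losing]. *)
Definition strategy (n : nat) := history n -> move n.

Definition follows (n : nat) (p : bool) (s : strategy n) (h : history n) : Prop :=
  forall h1 m h2, h = h1 ++ m :: h2 -> to_move h1 = p -> m = s h1.

Definition non_losing (n : nat) (p : bool) (s : strategy n) : Prop :=
  forall h, is_play h -> follows p s h ->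
    (~~ over h -> to_move h = p -> legal h (s h)) /\ ~~ won_by (~~ p) h.

Definition soso_is_draw (n : nat) : Prop :=
  forall p : bool, exists s : strategy n, non_losing p s.

(* Main.v *)
Require Import Defs.
From mathcomp Require Import all_boot.
From mathcomp Require Import zify.

(** The game is a draw because nobody can ever be forced to offer a win: in a
    position where no single move completes SOSO, the leftmost empty cell [x]
    can be filled without giving the opponent a winning reply.

    Suppose on the contrary that both S and O at [x] allow such a reply.  The
    reply completes a window of four cells that contains [x] and the cell of
    the reply, which lies to the right of [x], so [x] is not the last cell of
    the window.  If the letter at [x] is O, it is thus the second letter of the
    window: the cell [x-1] holds S, and one of [x+1], [x+2] is empty while the
    other holds S, respectively O.  If the letter at [x] is S, it is the first
    or the third letter.  As the third it needs O in [x-1], which holds S; as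
    the first it needs [x+1], [x+2] to be O, S up to one empty cell, but they
    read S-blank or blank-O.  Hence one of the two letters is safe
    ([safe_letter], [safe_move_exists]).

    Hence completing SOSO when this is possible, and making a safe move
    otherwise, never loses for either player: each of that player's moves ends
    the game or leaves a position with no winning move ([invariant]). *)

Set Implicit Arguments.
Unset Strict Implicit.
Unset Printing Implicit Defensive.

(** * SOSO on an unbounded row of cells *)

(** Rows are indexed by all natural numbers, cells beyond a board counting as
    empty, so that windows need no bound conditions. *)
Definition row := nat -> option letter.

Definition upd (f : row) (x : nat) (l : letter) : row :=
  fun j => if j == x then Some l else f j.

Definition soso_at (f : row) (a : nat) : Prop :=
  [/\ f a = Some LetS, f a.+1 = Some LetO, f a.+2 = Some LetS
    & f a.+3 = Some LetO].

Definition no_win_at (f : row) (x : nat) : Prop :=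
  forall l a, ~ soso_at (upd f x l) a.

Lemma eq_soso_at (f g : row) (a : nat) :
  (forall j, a <= j < a + 4 -> f j = g j) -> soso_at f a -> soso_at g a.
Proof. by move=> E [h0 h1 h2 h3]; split; rewrite -E //; lia. Qed.

(** A window completed by two moves, neither of which wins on its own, contains
    both of their cells: otherwise one of the moves could be dropped. *)
Lemma soso_two_moves (f : row) (x y a : nat) (l l' : letter) :
  no_win_at f x -> no_win_at f y -> soso_at (upd (upd f x l) y l') a ->
  a <= x < a + 4 /\ a <= y < a + 4.
Proof.
move=> Nx Ny W; split; apply/negP => /negP out.
  apply: (Ny l' a); apply: eq_soso_at W => j aj.
  by rewrite /upd; case: (j == y) => //; case: eqP => // jx; move: out; lia.
apply: (Nx l a); apply: eq_soso_at W => j aj.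
by rewrite /upd; case: (j =P y) => // jy; move: out; lia.
Qed.

Lemma reply_after_O (f : row) (x y a : nat) (l : letter) :
  no_win_at f x -> no_win_at f y -> f y = None -> x < y ->
  soso_at (upd (upd f x LetO) y l) a ->
  f x.-1 = Some LetS /\
  (f x.+1 = Some LetS /\ f x.+2 = None \/ f x.+1 = None /\ f x.+2 = Some LetO).
Proof.
move=> Nx Ny y0 xy W; have [ax ay] := soso_two_moves Nx Ny W.
have [xE|[xE|xE]] : x = a \/ x = a.+1 \/ x = a.+2 by lia.
- by case: W => + _ _ _; rewrite /upd ifF ?ifT //; lia.
- case: W => h0 _ h2 h3; subst x; split.
    by move: h0; rewrite /upd !ifF //; lia.
  have [yE|yE] : y = a.+2 \/ y = a.+3 by lia.
    by right; subst y; split=> //; move: h3; rewrite /upd !ifF //; lia.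
  by left; subst y; split=> //; move: h2; rewrite /upd !ifF //; lia.
- by case: W => _ _ + _; rewrite /upd xE eqxx ifF //; lia.
Qed.

Lemma reply_after_S (f : row) (x y a : nat) (l : letter) :
  no_win_at f x -> no_win_at f y -> x < y ->
  soso_at (upd (upd f x LetS) y l) a ->
  [\/ f x.-1 = Some LetO, f x.+1 = Some LetO | f x.+2 = Some LetS].
Proof.
move=> Nx Ny xy W; have [ax ay] := soso_two_moves Nx Ny W.
have [xE|[xE|xE]] : x = a \/ x = a.+1 \/ x = a.+2 by lia.
- case: W => _ h1 h2 _; subst x; have [yE|yE] := eqVneq y a.+1.
    by constructor 3; move: h2; rewrite /upd !ifF //; lia.
  by constructor 2; move: h1; rewrite /upd !ifF //; lia.
- by case: W => _ + _ _; rewrite /upd xE eqxx ifF //; lia.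
- case: W => _ h1 _ _; subst x.
  by constructor 1; move: h1; rewrite /upd !ifF //; lia.
Qed.

(** The two lists of constraints on the neighbours of [x] clash in every
    combination, so O and S at [x] cannot both be answered by a win. *)
Lemma safe_letter (f : row) (x y z a b : nat) (l l' : letter) :
  no_win_at f x -> no_win_at f y -> no_win_at f z -> f y = None ->
  x < y -> x < z ->
  soso_at (upd (upd f x LetO) y l) a ->
  soso_at (upd (upd f x LetS) z l') b -> False.
Proof.
move=> Nx Ny Nz y0 xy xz WO WS.
have [pS] := reply_after_O Nx Ny y0 xy WO.
by have [e|e|e] := reply_after_S Nx Nz xz WS; rewrite ?pS ?e in pS * => -[[]|[]].
Qed.

(** * Boards *)

Section Board.

Variable n : nat.
Implicit Types (b : board n) (m : move n) (h : history n) (p : bool).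

Definition cells b : row := nth None b.

Lemma cells_ord b (i : 'I_n) : cells b i = tnth b i.
Proof. by rewrite (tnth_nth None). Qed.

Lemma cells_write b m : cells (write b m) =1 upd (cells b) m.1 m.2.
Proof.
move=> j; rewrite /upd; have [jn|nj] := ltnP j n.
  by rewrite -[j]/(val (Ordinal jn)) !cells_ord tnth_mktuple -val_eqE.
rewrite /cells !nth_default ?size_tuple //.
by case: eqP => // jE; have := ltn_ord m.1; lia.
Qed.

Lemma has_sosoP b : reflect (exists a, soso_at (cells b) a) (has_soso b).
Proof.
apply: (iffP (@infixP _ [:: Some LetS; Some LetO; Some LetS; Some LetO] b))
  => [[u [v bE]]|[a [h0 h1 h2 h3]]].
  have E k : cells b (size u + k) =
      nth None ([:: Some LetS; Some LetO; Some LetS; Some LetO] ++ v) k.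
    by rewrite /cells bE [LHS]nth_cat ltnNge leq_addr addKn.
  exists (size u); have := (E 0, E 1, E 2, E 3).
  by rewrite addn0 addn1 addn2 addn3 /= => -[[[]]].
have in_b j l : cells b j = Some l -> j < size b.
  by rewrite /cells; case: ltnP => // ?; rewrite nth_default.
exists (take a b), (drop a.+4 b); rewrite -[LHS](cat_take_drop a) /=.
rewrite (drop_nth None (in_b _ _ h0)) (drop_nth None (in_b _ _ h1)).
rewrite (drop_nth None (in_b _ _ h2)) (drop_nth None (in_b _ _ h3)).
by move: h0 h1 h2 h3; rewrite /cells => -> -> -> ->.
Qed.

Definition open b m : bool := tnth b m.1 == None.

Definition winning b m : bool := open b m && has_soso (write b m).

Definition threatened b : bool := [exists m, winning b m].

Definition safe b m : bool := open b m && ~~ threatened (write b m).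

Lemma has_soso_writeP b m :
  reflect (exists a, soso_at (upd (cells b) m.1 m.2) a) (has_soso (write b m)).
Proof.
apply: (iffP (has_sosoP _)) => -[a W]; exists a; apply: eq_soso_at W => j _;
  by rewrite cells_write.
Qed.

Lemma no_win_open b (i : 'I_n) :
  ~~ threatened b -> tnth b i = None -> no_win_at (cells b) i.
Proof.
move=> /existsPn nt bi l a W; have /negP := nt (i, l); apply.
by rewrite /winning /open /= bi eqxx; apply/has_soso_writeP; exists a.
Qed.

(** A safe move can be found at the leftmost empty cell: all replies to it are
    further right, as [safe_letter] requires. *)
Lemma safe_move_exists b :
  ~~ threatened b -> ~~ full b -> exists m, safe b m.
Proof.
move=> nt; rewrite /full negbK => b0.
have xn : index None b < n by rewrite -[X in _ < X](size_tuple b) index_mem.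
pose x := Ordinal xn.
have bx : tnth b x = None by rewrite (tnth_nth None) nth_index.
have reply l : threatened (write b (x, l)) -> exists (y : 'I_n) l' a,
    [/\ x < y, tnth b y = None & soso_at (upd (upd (cells b) x l) y l') a].
  case/existsP=> -[y l'] /andP[/eqP /= yo /has_soso_writeP[a W]].
  move: yo; rewrite -cells_ord cells_write /upd /=.
  case: eqP => // yx yo; exists y, l', a; split.
  - have yb: y < size b by rewrite size_tuple.
    suff : x <= y by rewrite leq_eqVlt => /predU1P[/esym|].
    rewrite leqNgt; apply/negP => /(before_find None) /=.
    by rewrite -/(cells b y) yo eqxx.
  - by rewrite -cells_ord.
  - by apply: eq_soso_at W => j _; rewrite /upd cells_write.
case tO: (threatened (write b (x, LetO))); last first.
  by exists (x, LetO); rewrite /safe /open bx tO.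
case tS: (threatened (write b (x, LetS))); last first.
  by exists (x, LetS); rewrite /safe /open bx tS.
have [y [l [a [xy y0 WO]]]] := reply _ tO.
have [z [l' [c [xz z0 WS]]]] := reply _ tS.
have y0' : cells b y = None by rewrite cells_ord.
by case: (safe_letter (no_win_open nt bx) (no_win_open nt y0)
  (no_win_open nt z0) y0' xy xz WO WS).
Qed.

(** * The strategy *)

(** Win if possible, otherwise move safely; [m0] is a dummy value for positions
    with neither kind of move. *)
Definition careful (m0 : move n) : strategy n := fun h =>
  odflt (odflt m0 [pick m | safe (position h) m])
        [pick m | winning (position h) m].

Lemma carefulP (m0 : move n) h : ~~ Defs.over h ->
  winning (position h) (careful m0 h) || safe (position h) (careful m0 h).
Proof.
rewrite /Defs.over negb_or => /andP[_ nf]; rewrite /careful.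
case: (pickP [pred m | winning (position h) m]) => [m /= -> //|nw] /=.
have nt : ~~ threatened (position h).
  by apply/existsPn => m; have /= -> := nw m.
have [m sm] := safe_move_exists nt nf.
case: (pickP [pred m | safe (position h) m]) => [m' /= ->|/(_ m) /=].
  by rewrite orbT.
by rewrite sm.
Qed.

Lemma position_rcons h m : position (rcons h m) = write (position h) m.
Proof. by rewrite /position foldl_rcons. Qed.

Lemma cells_empty j : cells (empty_board n) j = None.
Proof.
have [jn|nj] := ltnP j n; last by rewrite /cells nth_default ?size_tuple.
by rewrite -[j]/(val (Ordinal jn)) cells_ord tnth_mktuple.
Qed.

Lemma empty_not_threatened : ~~ threatened (empty_board n).
Proof.
apply/existsPn => m; rewrite negb_and; apply/orP; right.
apply/has_soso_writeP => -[a [+ + _ _]]; rewrite /upd !cells_empty.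
by case: eqP => // <-; rewrite ifF //; lia.
Qed.

Lemma empty_no_soso : ~~ has_soso (empty_board n).
Proof. by apply/has_sosoP => -[a []]; rewrite cells_empty. Qed.

Lemma is_play_rcons h m : is_play (rcons h m) -> is_play h /\ legal h m.
Proof.
move=> P; split; last by apply: (P h m [::]); rewrite cats1.
by move=> h1 m1 h2 hE; apply: (P h1 m1 (rcons h2 m)); rewrite hE rcons_cat.
Qed.

Lemma follows_rcons p (s : strategy n) h m : follows p s (rcons h m) ->
  follows p s h /\ (to_move h = p -> m = s h).
Proof.
move=> F; split; last by apply: (F h m [::]); rewrite cats1.
by move=> h1 m1 h2 hE; apply: (F h1 m1 (rcons h2 m)); rewrite hE rcons_cat.
Qed.

(** The second alternative says that the opponent, being on turn, has no
    winning move unless the play is already over. *)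
Lemma invariant p (m0 : move n) h :
  is_play h -> follows p (careful m0) h ->
  if to_move h == p then ~~ has_soso (position h)
  else has_soso (position h) || ~~ threatened (position h).
Proof.
elim/last_ind: h => [|h m IH].
  by rewrite empty_no_soso empty_not_threatened orbT; case: ifP.
move=> /is_play_rcons[P /andP[no mo]] /follows_rcons[F mE].
have := IH P F; rewrite /to_move size_rcons /= -/(to_move h) position_rcons.
have ns : has_soso (position h) = false by case/norP: no => /negbTE.
have [tp _|tp] := eqVneq (to_move h) p.
  rewrite ifF; last by rewrite tp; case: (p).
  rewrite (mE tp).
  by case/orP: (carefulP m0 no) => /andP[_ ->]; rewrite ?orbT.
rewrite ns ifT /=; last by case: (to_move h) (p) tp => [] [].
by move/existsPn/(_ m); rewrite /winning /open mo.
Qed.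

End Board.

Theorem theorem7 (n : nat) (hn : 1 <= n) : soso_is_draw n.
Proof.
move=> p; pose m0 : move n := (Ordinal hn, LetS).
exists (careful m0) => h P F; split=> [no _|].
  by rewrite /legal no; case/orP: (carefulP m0 no) => /andP[].
have := invariant P F; rewrite /won_by negbK negb_and.
by case: (to_move h == p) => [->|]; rewrite ?orbT.
Qed.
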